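(* Let $(G,P)$ be a quasi-lattice ordered group with Nica spectrum $\Omega$ and core $(G_0,P_0)$. Then the canonical partial action of $G$ on its boundary spectrum $\partial\Omega$ is topologically free if and only if the (restricted) action of the core $G_0$ on $\partial\Omega$ is topologically free.
   Context: Groups are countable. A quasi-lattice ordered group $(G,P)$ is a group $G$ with a submonoid $P$ with $P\cap P^{-1}=\{e\}$ such that, for the left-invariant partial order $x\le y\iff x^{-1}y\in P$, every two elements of $G$ having a common upper bound have a least upper bound $x\vee y$; write $x\vee y=\infty$ if there is no common upper bound. Core: $P_0=\{x\in P: x\vee y\neq\infty\text{ for all }y\in P\}$ and $G_0=P_0P_0^{-1}$, which is the subgroup of $G$ generated by $P_0$. Nica spectrum: $\Omega$ is the set of $\omega\subset G$ with $e\in\omega$ that are hereditary ($\omega P^{-1}\subset\omega$) and directed ($x\vee y\ne\infty$ and $x\vee y\in\omega$ for $x,y\in\omega$), with the (compact Hausdorff) topology from $\{0,1\}^G$. $G$ acts partially on $\Omega$ by $\theta_t:U_{t^{-1}}\to U_t$, $\omega\mapsto t\omega$, where $U_t=\{\omega:t\in\omega\}$. The boundary spectrum $\partial\Omega$ is the closure in $\Omega$ of the set of maximal directed subsets of $G$ containing $e$ (these are automatically hereditary); it is closed and invariant. The partial action of a subgroup $K\le G$ on $\partial\Omega$ is topologically free if for every $t\in K\setminus\{e\}$ the fixed set $\{\omega\in\partial\Omega\cap U_{t^{-1}}:t\omega=\omega\}$ has empty interior in $\partial\Omega$. *)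

(* Defs.v *)
From HB Require Import structures.
From mathcomp Require Import all_boot.
From mathcomp Require Import all_classical.
From mathcomp Require Import topology.

Set Implicit Arguments.
Unset Strict Implicit.
Unset Printing Implicit Defensive.

Local Open Scope classical_set_scope.
Local Open Scope group_scope.

Definition left_le (G : groupType) (P : set G) (x y : G) : Prop :=
  P (x^-1 * y).

Definition upper_bound2 (G : groupType) (P : set G) (x y z : G) : Prop :=
  left_le P x z /\ left_le P y z.

(* [is_join P x y z] is the graph of the partial operation z = x \/ y: such a z
   is unique when P `&` P^-1 = 1. *)
Definition is_join (G : groupType) (P : set G) (x y z : G) : Prop :=
  upper_bound2 P x y z /\ forall u, upper_bound2 P x y u -> left_le P z u.

(* "x \/ y <> oo" *)
Definition join_finite (G : groupType) (P : set G) (x y : G) : Prop :=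
  exists z, upper_bound2 P x y z.

Record quasi_lattice_ordered (G : groupType) (P : set G) : Prop := {
  qlo_one : P 1;
  qlo_mul : forall x y, P x -> P y -> P (x * y);
  qlo_inv : P `&` [set x | P x^-1] = [set 1];
  qlo_join : forall x y, join_finite P x y -> exists z, is_join P x y z
}.

Definition core_monoid (G : groupType) (P : set G) : set G :=
  [set x | P x /\ forall y, P y -> join_finite P x y].

Definition core_group (G : groupType) (P : set G) : set G :=
  [set t | exists x y, [/\ core_monoid P x, core_monoid P y & t = x * y^-1]].

Definition hereditary (G : groupType) (P A : set G) : Prop :=
  forall x p, A x -> P p -> A (x * p^-1).

Definition directed (G : groupType) (P A : set G) : Prop :=
  forall x y, A x -> A y -> exists z, is_join P x y z /\ A z.

Definition maximal_directed (G : groupType) (P A : set G) : Prop :=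
  directed P A /\ forall B, directed P B -> A `<=` B -> B = A.

(* The space {0,1}^G, with the product topology; [bool] is discrete. *)
Definition subset_space (G : groupType) : topologicalType := {ptws G -> bool}.

Definition support_set (G : groupType) (w : subset_space G) : set G :=
  [set x | w x].

Definition nica_spectrum (G : groupType) (P : set G) : set (subset_space G) :=
  [set w | [/\ support_set w 1, hereditary P (support_set w)
             & directed P (support_set w)]].

(* The closure in the subspace [nica_spectrum P] is the trace on it of the
   closure in {0,1}^G. *)
Definition boundary_spectrum (G : groupType) (P : set G) :
    set (subset_space G) :=
  nica_spectrum P `&`
  closure [set w : subset_space G | maximal_directed P (support_set w)
                                    /\ support_set w 1].

Definition U_ (G : groupType) (t : G) : set (subset_space G) :=
  [set w | support_set w t].

(* Indicator function of the translate t w = {t x | x in w}. The partial action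
   theta_t is the restriction of this map to U_ t^-1. *)
Definition translate (G : groupType) (t : G) (w : subset_space G) :
    subset_space G := fun x => w (t^-1 * x).

Definition boundary_fixed (G : groupType) (P : set G) (t : G) :
    set (subset_space G) :=
  [set w | [/\ boundary_spectrum P w, U_ t^-1 w & translate t w = w]].

(* [subspace B] keeps the ambient carrier, with the points outside B isolated.
   Since [boundary_fixed P t] lies in B, its interior in [subspace B] is its
   interior relative to B. *)
Definition topologically_free (G : groupType) (P K : set G) : Prop :=
  forall t, K t -> t <> 1 ->
    interior (boundary_fixed P t : set (subspace (boundary_spectrum P))) = set0.

(* Main.v *)
(** If t fixes a nonempty relatively open subset of the boundary, then, maximal
    sets being dense, it fixes every maximal set containing some x >= e.
    Translating by x^-1, the conjugate s = x^-1 t x fixes every maximal set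
    containing e, hence the whole boundary. Then s and s^-1 belong to every such
    set. As every y in P lies in one of them, p = s \/ e and q = s^-1 \/ e have
    common upper bounds with every y in P, i.e. they lie in P_0; and s^-1 p = q,
    so s = p q^-1 is in the core. *)
Require Import Defs.
From HB Require Import structures.
From mathcomp Require Import all_boot.
From mathcomp Require Import all_classical.
From mathcomp Require Import topology.

Local Open Scope classical_set_scope.
Local Open Scope group_scope.

(** * Pointwise topology on [{0,1}^G] *)

Lemma ptws_cvg (T : Type) (V : topologicalType)
    (F : set_system {ptws T -> V}) (f : {ptws T -> V}) :
  Filter F -> (forall t, (g t @[g --> F]) --> f t) -> F --> f.
Proof.
move=> FF Ff; apply/cvg_sup => t; apply/cvg_image.
  (* Constant functions show that evaluation at [t] is onto, so convergence of the image filter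
     lifts back along it. *)
  by rewrite eqEsubset; split=> v // _; exists (cst v).
move=> W /= /Ff FW; exists (@^~ t @^-1` W) => //.
by rewrite eqEsubset; split => [j [? + <-//]|j Wj]; exists (fun=> j).
Qed.

(** At [h] the equation compares only the coordinates [s^-1 * h] and [h], and each coordinate is
    locally constant because [bool] is discrete. *)
Lemma fixed_closed (G : groupType) (s : G) :
  closed [set w : subset_space G | translate s w = w].
Proof.
move=> w clw; apply/funext => h.
have near_eq (g : G) : nbhs w [set v : subset_space G | v g = w g].
  exact: (@proj_continuous G (fun=> bool) g w [set w g] (discrete_set1 _)).
have [v [/= sv [vs vh]]] := clw _ (filterI (near_eq (s^-1 * h)) (near_eq h)).
exact: etrans (esym vs) (etrans (congr1 (@^~ h) sv) vh).
Qed.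

Lemma translate_fixed_mem (G : groupType) (s : G) (w : subset_space G) :
  translate s w = w -> support_set w 1 ->
  support_set w s /\ support_set w s^-1.
Proof.
rewrite /support_set /= => sw w1; split.
  by rewrite -sw /translate mulVg.
by rewrite -[s^-1]mulg1 -[w _]/(translate s w 1) sw.
Qed.

Section quasi_lattice.
Context {G : groupType} {P : set G}.
Hypothesis qloP : quasi_lattice_ordered P.

(** * Order, joins and left translation *)

Lemma left_le_refl x : left_le P x x.
Proof. by rewrite /left_le mulVg; exact: qlo_one qloP. Qed.

Lemma left_le_trans y x z : left_le P x y -> left_le P y z -> left_le P x z.
Proof.
move=> xy yz; rewrite /left_le.
have -> : x^-1 * z = (x^-1 * y) * (y^-1 * z) by rewrite -mulgA mulVKg.
exact: qlo_mul qloP _ _ xy yz.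
Qed.

Lemma left_le_mul2l (g x y : G) : left_le P (g * x) (g * y) = left_le P x y.
Proof. by rewrite /left_le invgM -mulgA mulKg. Qed.

Lemma is_join_refl x : is_join P x x x.
Proof.
split; first by split; exact: left_le_refl.
by move=> u [].
Qed.

Lemma is_join_mul2l (g x y z : G) :
  is_join P x y z -> is_join P (g * x) (g * y) (g * z).
Proof.
move=> [[xz yz] zmin]; split; first by split; rewrite left_le_mul2l.
move=> u [xu yu]; rewrite -(mulVKg g u) left_le_mul2l.
by apply: zmin; split; rewrite -(left_le_mul2l g) mulVKg.
Qed.

Lemma hereditary_le {A : set G} {x y} :
  hereditary P A -> A y -> left_le P x y -> A x.
Proof.
move=> hA Ay xy; have := hA _ _ Ay xy.
by rewrite invgM invgK mulVKg.
Qed.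

(** A least upper bound lies below any upper bound found in [A], so closure downwards puts it in
    [A]. *)
Lemma lower_directed (A : set G) :
  (forall x y, A y -> left_le P x y -> A x) ->
  (forall x y, A x -> A y -> exists2 z, A z & upper_bound2 P x y z) ->
  directed P A.
Proof.
move=> lowA ubA x y Ax Ay; have [u Au xyu] := ubA _ _ Ax Ay.
have [z zj] : exists z, is_join P x y z by apply: (qlo_join qloP); exists u.
by exists z; split => //; apply: (lowA z u Au); exact: zj.2.
Qed.

(** * Maximal directed sets *)

(** The downward closure of a directed set is again directed, so maximality makes it equal to
    [A]. *)
Lemma maximal_directed_hereditary {A : set G} :
  maximal_directed P A -> hereditary P A.
Proof.
move=> [dA maxA]; pose B := [set x | exists2 a, A a & left_le P x a].
have BA : B = A.
  apply: maxA; last by move=> a Aa; exists a => //; exact: left_le_refl.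
  apply: lower_directed.
    by move=> x y [a Aa ya] xy; exists a => //; exact: left_le_trans ya.
  move=> x y [a Aa xa] [b Ab yb]; have [c [[[ac bc] _] Ac]] := dA _ _ Aa Ab.
  exists c; first by exists c => //; exact: left_le_refl.
  by split; [exact: left_le_trans ac|exact: left_le_trans bc].
move=> x p Ax Pp; rewrite -BA; exists x => //.
by rewrite /left_le invgM invgK mulgVK.
Qed.

(** The elements below some join of [y] with a member of [A] form a directed set containing [A] and
    [y]; by maximality it is [A]. *)
Lemma maximal_directed_join_mem {A : set G} {y : G} :
  maximal_directed P A -> A !=set0 ->
  (forall z, A z -> join_finite P y z) -> A y.
Proof.
move=> [dA maxA] [a Aa] yA.
pose B := [set u | exists z j, [/\ A z, is_join P y z j & left_le P u j]].
have joinE z : A z -> exists j, is_join P y z j.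
  by move=> /yA; exact: qlo_join qloP _ _.
suff <- : B = A.
  by have [j j_ya] := joinE a Aa; exists a, j; split => //; exact: j_ya.1.1.
apply: maxA; last first.
  move=> z Az; have [j j_yz] := joinE z Az.
  by exists z, j; split => //; exact: j_yz.1.2.
apply: lower_directed.
  move=> u v [z [j [Az jz vj]]] uv; exists z, j; split => //.
  exact: left_le_trans vj.
move=> u1 u2 [z1 [j1 [Az1 [_ j1min] u1j1]]] [z2 [j2 [Az2 [_ j2min] u2j2]]].
have [z [[[z1z z2z] _] Az]] := dA _ _ Az1 Az2.
have [j jz] := joinE z Az; have [[yj zj] _] := jz.
exists j; first by exists z, j; split => //; exact: left_le_refl.
split; [apply: left_le_trans u1j1 _; apply: j1min
       |apply: left_le_trans u2j2 _; apply: j2min];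
  by split => //; exact: left_le_trans zj.
Qed.

Lemma maximal_directed_exists (y : G) :
  exists2 A : set G, maximal_directed P A & A y.
Proof.
(* Zorn's lemma for unions also covers the empty chain, so [Q] must hold of the empty set; hence [y]
   is required only in nonempty sets. *)
pose Q (A : set G) := directed P A /\ (A !=set0 -> A y).
have [|A [[dA Ay] maxA]] := @Zorn_bigcup G Q.
  move=> F FQ totF; split.
    move=> u v [X FX Xu] [Y FY Yv].
    have [XY|YX] := totF X Y FX FY.
      have [z [zj Yz]] := (FQ Y FY).1 _ _ (XY _ Xu) Yv.
      by exists z; split => //; exists Y.
    have [z [zj Xz]] := (FQ X FX).1 _ _ Xu (YX _ Yv).
    by exists z; split => //; exists X.
  by move=> [u [X FX Xu]]; exists X => //; apply: (FQ X FX).2; exists u.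
have {}Ay : A y.
  apply: contrapT => nAy; apply: (maxA [set y]).
    split; last by move=> /(_ y erefl).
    by move=> a Aa; case: nAy; apply: Ay; exists a.
  split; last by move=> _.
  by move=> u v -> ->; exists y; split => //; exact: is_join_refl.
exists A => //; split => // B dB AB; apply: contrapT => BA.
apply: (maxA B); last by split => // _; exact: AB.
by split=> // BsubA; apply: BA; apply/seteqP; split.
Qed.

Lemma directed_lmul (g : G) (A : set G) :
  directed P A -> directed P [set x | A (g^-1 * x)].
Proof.
move=> dA x y Ax Ay; have [z [zj Az]] := dA _ _ Ax Ay.
exists (g * z); rewrite /= mulKg; split => //.
by have := is_join_mul2l g _ _ _ zj; rewrite !mulVKg.
Qed.

(** A directed set containing the translate of [A] pulls back along [g] to a directed set containing
    [A]. *)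
Lemma maximal_directed_lmul (g : G) (A : set G) :
  maximal_directed P A -> maximal_directed P [set x | A (g^-1 * x)].
Proof.
move=> [dA maxA]; split; first exact: directed_lmul.
move=> B dB AB.
have /maxA <- : directed P [set x | B (g^-1^-1 * x)] by exact: directed_lmul.
  by apply/seteqP; split=> x /=; rewrite invgK mulVKg.
by move=> x Ax /=; rewrite invgK; apply: AB; rewrite /= mulKg.
Qed.

(** * Membership in the core *)

(** A maximal set through [y] in [P] contains 1, hence [s] and their join [p]; its directedness then
    bounds [p] and [y] together. *)
Lemma core_monoid_join {s p : G} :
  (forall A, maximal_directed P A -> A 1 -> A s) ->
  is_join P s 1 p -> core_monoid P p.
Proof.
move=> sA pj; have Pp : P p by move: pj.1.2; rewrite /left_le invg1 mul1g.
split=> // y Py; have [A mA Ay] := maximal_directed_exists y.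
have hA := maximal_directed_hereditary mA.
have A1 : A 1 by apply: hereditary_le hA Ay _; rewrite /left_le invg1 mul1g.
have [z [zj Az]] := mA.1 _ _ (sA A mA A1) A1.
have Ap : A p by apply: hereditary_le hA Az _; apply: pj.2; exact: zj.1.
by have [u [[uub _] _]] := mA.1 _ _ Ap Ay; exists u.
Qed.

Lemma core_group_of_mem_maximal (s : G) :
  (forall A, maximal_directed P A -> A 1 -> A s) ->
  (forall A, maximal_directed P A -> A 1 -> A s^-1) ->
  core_group P s.
Proof.
move=> sA sVA; have [A mA A1] := maximal_directed_exists 1.
have [p [pj _]] := mA.1 _ _ (sA A mA A1) A1.
(* Translating the join of [s] and 1 by [s^-1] gives the join of 1 and [s^-1]. *)
have qj : is_join P s^-1 1 (s^-1 * p).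
  have := is_join_mul2l s^-1 _ _ _ pj; rewrite mulVg mulg1.
  by move=> [[? ?] qmin]; split=> // u [? ?]; exact: qmin.
exists p, (s^-1 * p); split; first exact: core_monoid_join sA pj.
  exact: core_monoid_join sVA qj.
by rewrite invgM invgK mulVKg.
Qed.

(** * Neighbourhoods and density in the boundary *)

Lemma maximal_nbhs (m : subset_space G) (U : set (subset_space G)) :
  maximal_directed P (support_set m) -> support_set m 1 -> nbhs m U ->
  exists2 x, support_set m x &
    forall w, hereditary P (support_set w) -> directed P (support_set w) ->
      support_set w x -> U w.
Proof.
move=> mm m1 mU.
(* As m is directed, the sets [B x] with x in m form a filter base; m being
   maximal, every g outside m lacks a common upper bound with some x in m, so
   this filter converges pointwise to m. *)
pose B x : set (subset_space G) :=
  [set w | [/\ hereditary P (support_set w), directed P (support_set w)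
             & support_set w x]].
have BF : Filter (filter_from (support_set m) B).
  apply: filter_from_filter; first by exists 1.
  move=> x y mx my; have [z [[[xz yz] _] mz]] := mm.1 _ _ mx my.
  exists z => // w [hw dw wz]; split; split => //;
  by apply: hereditary_le hw wz _.
have : filter_from (support_set m) B --> m.
  apply: ptws_cvg => g; apply/discrete_cvg => /=.
  have [mg|nmg] := pselect (support_set m g).
    by exists g => // w [_ _ wg]; exact: etrans wg (esym mg).
  have [x [mx gx]] : exists x, support_set m x /\ ~ join_finite P g x.
    apply: contrapT => nx; apply: nmg.
    apply: (maximal_directed_join_mem mm); first by exists 1.
    by move=> z mz; apply: contrapT => gz; apply: nx; exists z.
  exists x => // w [hw dw wx] /=.
  move: nmg => /negP/negbTE ->; apply/negbTE/negP => wg; apply: gx.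
  by have [z [[zub _] _]] := dw _ _ wg wx; exists z.
by move=> /(_ U mU)[x mx BU]; exists x => // w hw dw wx; exact: BU.
Qed.

Lemma boundary_closed_subset (C : set (subset_space G)) :
  closed C ->
  (forall w, maximal_directed P (support_set w) -> support_set w 1 -> C w) ->
  boundary_spectrum P `<=` C.
Proof.
move=> cC mC w [_ clw]; apply: cC; apply: closure_subset clw.
by move=> v [mv v1]; exact: mC.
Qed.

Lemma maximal_boundary (w : subset_space G) :
  maximal_directed P (support_set w) -> support_set w 1 ->
  boundary_spectrum P w.
Proof.
move=> mw w1; split; last by apply: subset_closure.
by split=> //; [exact: maximal_directed_hereditary|exact: mw.1].
Qed.

Lemma boundary_fixed_full (s : G) :
  (forall w : subset_space G, maximal_directed P (support_set w) ->
     support_set w 1 -> translate s w = w) ->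
  boundary_spectrum P `<=` boundary_fixed P s.
Proof.
move=> sfix w bw.
have sw : translate s w = w.
  exact: boundary_closed_subset (fixed_closed _ s) sfix _ bw.
have [[w1 _ _] _] := bw.
by split=> //; exact: (translate_fixed_mem _ _ _ sw w1).2.
Qed.

End quasi_lattice.

Theorem proposition5p5 (G : groupType) (P : set G) :
  countable [set: G] -> quasi_lattice_ordered P ->
  (topologically_free P [set: G] <-> topologically_free P (core_group P)).
Proof.
move=> _ qloP; split=> [freeG t _|freeK t _ t1]; first exact: freeG.
apply/seteqP; split=> // w wint.
have [bw _ _] := interior_subset wint.
have {}wint : within (boundary_spectrum P) (nbhs (w : subset_space G))
    (boundary_fixed P t).
  by rewrite nbhs_subspace_in.
(* Passing to the interior makes the set a neighbourhood also of the maximal point [m] that density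
   provides. *)
move: wint => /nbhs_interior wint.
have [m [[mm m1] mint]] := bw.2 _ wint.
have [x0 mx0 x0fix] := maximal_nbhs qloP _ _ mm m1 mint.
(* Joining [x0] with 1 gives [x] in [P]: whenever [v] contains 1, its translate by [x] contains [x],
   hence both [x0] and 1. *)
have [x [[[x0x]]]] := mm.1 _ _ mx0 m1.
rewrite /left_le invg1 mul1g => Px _ mx.
pose s := x^-1 * t * x.
have sfix (v : subset_space G) :
    maximal_directed P (support_set v) -> support_set v 1 -> translate s v = v.
  move=> mv v1.
  have mxv : maximal_directed P (support_set (translate x v)).
    exact: (maximal_directed_lmul x _ mv).
  have xvx : support_set (translate x v) x.
    by rewrite /support_set /translate /= mulVg.
  have hxv := maximal_directed_hereditary qloP mxv.
  have xv1 : support_set (translate x v) 1.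
    by apply: (hereditary_le hxv xvx); rewrite /left_le invg1 mul1g.
  have xvx0 := hereditary_le hxv xvx x0x.
  have [_ _ txv] := x0fix _ hxv mxv.1 xvx0 (maximal_boundary qloP _ mxv xv1).
  (* Evaluating the [t]-invariance of the translate of [v] at [x * h] gives the [s]-invariance of
     [v] at [h]. *)
  apply/funext => h; have := congr1 (@^~ (x * h)) txv.
  by rewrite /translate mulKg => <-; rewrite /s !invgM invgK !mulgA.
have smem (A : set G) : maximal_directed P A -> A 1 -> A s /\ A s^-1.
  move=> mA A1; pose v : subset_space G := fun g => `[<A g>].
  have vA : support_set v = A by apply/seteqP; split=> g /asboolP.
  by rewrite -vA; apply: translate_fixed_mem; [apply: sfix|]; rewrite vA.
have Ks : core_group P s.
  by apply: (core_group_of_mem_maximal qloP) => A mA /(smem A mA)[].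
have s1 : s <> 1.
  move=> s1; apply: t1; have -> : t = x * s * x^-1.
    by rewrite /s !mulgA mulgV mul1g mulgK.
  by rewrite s1 mulg1 mulgV.
(* Since [s] fixes the whole boundary, the boundary point [m] is interior to its fixed set, against
   freeness of the core. *)
have : interior (boundary_fixed P s : set (subspace (boundary_spectrum P))) m.
  have bm := maximal_boundary qloP m mm m1.
  suff: within (boundary_spectrum P) (nbhs m) (boundary_fixed P s).
    by rewrite nbhs_subspace_in.
  by rewrite /within /=; apply: filterE => v; exact: (boundary_fixed_full s sfix).
by rewrite (freeK s Ks s1).
Qed.
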